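(* Let $Q(t)$ be an arbitrary smooth function, $H(t)=\int Q(t)\,dt$ and $L(t)=\int e^{-\int Q(t)\,dt}\,dt$. The equation $$u_t + u\,u_x + u_{xxx} + Q(t)\,u = 0$$ (that is, the equation $u_t + A(t)u^n u_x + u^{2n}u_x + u_{xxx} + Q(t)u = 0$ with $n=\tfrac12$ and $A(t)=0$) admits, for an arbitrary constant $\tilde c_3$, the conservation law multiplier $$\Lambda=\tilde c_3\left(e^{H}x-e^{2H}L\,u\right),$$ and from it one obtains the conservation law $D_tT+D_xX=0$ (holding on all solutions $u(t,x)$ of the equation) with conserved vector $$T=\frac{\tilde c_3}{2}\left(2e^{H}x\,u-e^{2H}L\,u^2\right),$$ $$X=\frac{\tilde c_3}{6}\left(e^{H}x\left(6u_{xx}+3u^2\right)-e^{2H}L\left(2u^3-3u_x^2+6uu_{xx}\right)-6e^{H}u_x\right).$$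
   Context: $D_t$ and $D_x$ denote the total derivative operators with respect to $t$ and $x$. A multiplier is a function $\Lambda(t,x,u,u_x,u_{xx},\ldots)$ such that $$\left(u_t+u u_x+u_{xxx}+Qu\right)\Lambda$$ is a divergence expression (of the form $D_t(\cdot)+D_x(\cdot)$) for all functions $u(t,x)$, not just solutions of the equation. $H$ is a fixed antiderivative of $Q$, and $L$ is a fixed antiderivative of $e^{-H}$ (with the same $H$). *)

(* Defs.v *)
(* Stdlib real numbers with Coquelicot. *)
From Stdlib Require Import Reals List.
From Coquelicot Require Import Coquelicot.

Open Scope R_scope.

(** ** The jet space of functions u(t,x) *)

(** [cu i j] is the coordinate of the derivative of [u] taken [i] times in
    [t] and [j] times in [x]. *)
Inductive coord : Set :=
| ct : coord
| cx : coord
| cu : nat -> nat -> coord.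

Definition coord_eq_dec (c d : coord) : {c = d} + {c <> d}.
Proof. decide equality; apply Nat.eq_dec. Defined.

Definition jet : Type := coord -> R.

Definition update (p : jet) (c : coord) (s : R) : jet :=
  fun d => if coord_eq_dec c d then s else p d.

Definition ex_partial (c : coord) (F : jet -> R) (p : jet) : Prop :=
  ex_derive (fun s => F (update p c s)) (p c).

Definition partial (c : coord) (F : jet -> R) : jet -> R :=
  fun p => Derive (fun s => F (update p c s)) (p c).

Definition partials (l : list coord) (F : jet -> R) : jet -> R :=
  fold_right partial F l.

(** ** Differential functions and total derivatives *)

Definition finite_order (F : jet -> R) : Prop :=
  exists n : nat, forall p q : jet,
    p ct = q ct -> p cx = q cx ->
    (forall i j : nat, (i + j <= n)%nat -> p (cu i j) = q (cu i j)) ->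
    F p = F q.

(** Dependence on t, x, u, u_x, u_xx, ... only (finitely many of them). *)
Definition finite_x_order (F : jet -> R) : Prop :=
  exists n : nat, forall p q : jet,
    p ct = q ct -> p cx = q cx ->
    (forall j : nat, (j <= n)%nat -> p (cu 0 j) = q (cu 0 j)) ->
    F p = F q.

(** [continuous] refers to the uniform structure of [coord -> R]; on a function
    of finite order it is ordinary continuity in the finitely many coordinates
    on which the function depends. *)
Definition smooth_jet_fun (F : jet -> R) : Prop :=
  forall (l : list coord) (p : jet),
    continuous (partials l F) p /\
    (forall c : coord, ex_partial c (partials l F) p).

Definition differential_function (F : jet -> R) : Prop :=
  finite_order F /\ smooth_jet_fun F.

(** D_t = d/dt + u_t d/du + u_tt d/du_t + u_tx d/du_x + ...,
    the terms being grouped by the order k = i + j of the coordinate u_(i,j);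
    on a function of finite order only finitely many groups are nonzero. *)
Definition total_Dt (F : jet -> R) : jet -> R := fun p =>
  partial ct F p +
  Series (fun k : nat =>
    sum_f_R0 (fun i : nat =>
      p (cu (S i) (k - i)%nat) * partial (cu i (k - i)%nat) F p) k).

Definition total_Dx (F : jet -> R) : jet -> R := fun p =>
  partial cx F p +
  Series (fun k : nat =>
    sum_f_R0 (fun i : nat =>
      p (cu i (S (k - i)%nat)) * partial (cu i (k - i)%nat) F p) k).

(** ** Functions u(t,x) and their jets *)

Definition pdt (u : R -> R -> R) : R -> R -> R :=
  fun t x => Derive (fun s => u s x) t.

Definition pdx (u : R -> R -> R) : R -> R -> R :=
  fun t x => Derive (fun y => u t y) x.

(** In the word [l], [true] stands for d/dt and [false] for d/dx. *)
Definition pds (l : list bool) (u : R -> R -> R) : R -> R -> R :=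
  fold_right (fun (b : bool) v => if b then pdt v else pdx v) u l.

Definition smooth_on (D : R * R -> Prop) (u : R -> R -> R) : Prop :=
  forall (l : list bool) (t x : R), D (t, x) ->
    continuous (fun z : R * R => pds l u (fst z) (snd z)) (t, x) /\
    ex_derive (fun s => pds l u s x) t /\
    ex_derive (fun y => pds l u t y) x.

Definition prolong (u : R -> R -> R) (t x : R) : jet := fun c =>
  match c with
  | ct => t
  | cx => x
  | cu i j => Nat.iter i pdt (Nat.iter j pdx u) t x
  end.

Definition solution_on (D : R * R -> Prop) (E : jet -> R) (u : R -> R -> R)
  : Prop :=
  smooth_on D u /\ forall t x : R, D (t, x) -> E (prolong u t x) = 0.

(** ** Multipliers and conservation laws *)

(** [E * Lam = D_t T + D_x X] for all functions u(t,x), on any open domain. *)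
Definition characteristic_form (E Lam T X : jet -> R) : Prop :=
  differential_function T /\ differential_function X /\
  forall (D : R * R -> Prop) (u : R -> R -> R),
    open D -> smooth_on D u ->
    forall t x : R, D (t, x) ->
      E (prolong u t x) * Lam (prolong u t x) =
      total_Dt T (prolong u t x) + total_Dx X (prolong u t x).

Definition is_multiplier (E Lam : jet -> R) : Prop :=
  finite_x_order Lam /\ smooth_jet_fun Lam /\
  exists T X : jet -> R, characteristic_form E Lam T X.

Definition is_conservation_law (E T X : jet -> R) : Prop :=
  differential_function T /\ differential_function X /\
  forall (D : R * R -> Prop) (u : R -> R -> R),
    open D -> solution_on D E u ->
    forall t x : R, D (t, x) ->
      total_Dt T (prolong u t x) + total_Dx X (prolong u t x) = 0.

(** ** The equation *)

Definition smooth (Q : R -> R) : Prop :=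
  forall (n : nat) (t : R), ex_derive_n Q n t.

(** u_t + A(t) u^n u_x + u^(2n) u_x + u_xxx + Q(t) u, for a real exponent [n];
    [Rpower] is the real power only for a positive base, hence this is the
    intended expression where u > 0. *)
Definition general_equation (n : R) (A Q : R -> R) : jet -> R := fun p =>
  p (cu 1 0) + A (p ct) * Rpower (p (cu 0 0)) n * p (cu 0 1)
  + Rpower (p (cu 0 0)) (2 * n) * p (cu 0 1)
  + p (cu 0 3) + Q (p ct) * p (cu 0 0).

Definition equation (Q : R -> R) : jet -> R := fun p =>
  p (cu 1 0) + p (cu 0 0) * p (cu 0 1) + p (cu 0 3) + Q (p ct) * p (cu 0 0).

(* Main.v *)
(** The identity [E * Lam = D_t T + D_x X] holds at every point of the jet space: [T] and [X] have
    finite order, so the series in the total derivatives are finite sums, and what is left is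
    algebra using [H' = Q] and [exp (2 H) * L' = exp H]. The other point is that [Lam], [T] and [X]
    are smooth; [exp (k H)] and [L] are handled by induction on the order of differentiation, since
    their derivatives are products of themselves, [Q] and [exp (- H)]. *)

Require Import Defs.
From Stdlib Require Import Reals List Lia FunctionalExtensionality.
From Coquelicot Require Import Coquelicot.
Open Scope R_scope.

Lemma update_same (p : jet) (c : coord) : update p c (p c) = p.
Proof.
apply functional_extensionality; intro d; unfold update.
now destruct (coord_eq_dec c d) as [<-|].
Qed.

(** ** Smooth functions on the jet space *)

(** Smoothness is graded by the number of partial derivatives, so that the product and chain rules
    can be iterated by induction on [n]. *)
Fixpoint n_smooth (n : nat) (F : jet -> R) : Prop :=
  (forall p, continuous F p /\ forall c, ex_partial c F p) /\
  match n with
  | O => True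
  | S m => forall c, n_smooth m (partial c F)
  end.

Lemma n_smooth_regular (n : nat) (F : jet -> R) (p : jet) :
  n_smooth n F -> continuous F p /\ forall c, ex_partial c F p.
Proof. now destruct n; intros [h _]. Qed.

Lemma n_smooth_pred (n : nat) (F : jet -> R) : n_smooth (S n) F -> n_smooth n F.
Proof.
revert F; induction n as [|n IH]; intros F [h h']; split; auto.
Qed.

Lemma smooth_jet_fun_of_n_smooth (F : jet -> R) :
  (forall n, n_smooth n F) -> smooth_jet_fun F.
Proof.
(* [partials] is a right fold, so the last letter of the word acts on [F] first; induction from the
   right peels off that letter, as [n_smooth] does. *)
intros h l; revert F h; induction l as [|c l IH] using rev_ind; intros F h p.
- apply (n_smooth_regular 0), h.
- unfold partials; rewrite fold_right_app; apply (IH (partial c F)).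
  intro n; apply (h (S n)).
Qed.

Lemma is_derive_partial (F : jet -> R) (c : coord) (p : jet) :
  ex_partial c F p -> is_derive (fun s => F (update p c s)) (p c) (partial c F p).
Proof. apply Derive_correct. Qed.

Lemma n_smooth_const (n : nat) (a : R) : n_smooth n (fun _ => a).
Proof.
revert a; induction n as [|n IH]; intro a; split; auto.
1,2: intro p; split; [apply continuous_const | intro c; apply (ex_derive_const a (p c))].
intro c; replace (partial c (fun _ : jet => a)) with (fun _ : jet => 0); [apply IH|].
apply functional_extensionality; intro p; symmetry; exact (Derive_const a (p c)).
Qed.

Lemma n_smooth_plus (n : nat) (F G : jet -> R) :
  n_smooth n F -> n_smooth n G -> n_smooth n (fun p => F p + G p).
Proof.
revert F G; induction n as [|n IH]; intros F G hF hG.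
all: assert (hr : forall p, continuous (fun p => F p + G p) p /\
       forall c, ex_partial c (fun p => F p + G p) p)
  by (intro p; destruct (n_smooth_regular _ _ p hF) as [cF dF];
      destruct (n_smooth_regular _ _ p hG) as [cG dG]; split;
      [apply (continuous_plus F G p cF cG)
      |intro c; apply (ex_derive_plus _ _ _ (dF c) (dG c))]).
- now split.
- split; [exact hr|intro c].
  replace (partial c (fun p => F p + G p)) with (fun p => partial c F p + partial c G p).
  { apply IH; [apply hF|apply hG]. }
  apply functional_extensionality; intro p; symmetry;
  apply (Derive_plus (fun s => F (update p c s)));
    [apply (n_smooth_regular _ _ p hF)|apply (n_smooth_regular _ _ p hG)].
Qed.

Lemma n_smooth_mult (n : nat) (F G : jet -> R) :
  n_smooth n F -> n_smooth n G -> n_smooth n (fun p => F p * G p).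
Proof.
revert F G; induction n as [|n IH]; intros F G hF hG.
all: assert (hr : forall p, continuous (fun p => F p * G p) p /\
       forall c, ex_partial c (fun p => F p * G p) p)
  by (intro p; destruct (n_smooth_regular _ _ p hF) as [cF dF];
      destruct (n_smooth_regular _ _ p hG) as [cG dG]; split;
      [apply (continuous_mult F G p cF cG)
      |intro c; apply (ex_derive_mult _ _ _ (dF c) (dG c))]).
- now split.
- split; [exact hr|intro c].
  replace (partial c (fun p => F p * G p))
    with (fun p => partial c F p * G p + F p * partial c G p).
  (* In each summand one factor is left undifferentiated; its order is lowered from [S n] to [n]. *)
  { apply n_smooth_plus; apply IH; solve [apply hF | apply hG | now apply n_smooth_pred]. }
  apply functional_extensionality; intro p; symmetry; unfold partial.
  rewrite Derive_mult, update_same; [reflexivity| |];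
    [apply (n_smooth_regular _ _ p hF)|apply (n_smooth_regular _ _ p hG)].
Qed.

(** By the chain rule each partial derivative is [partial c F] times the same exponential, so the
    induction closes through products. *)
Lemma n_smooth_exp (n : nat) (F : jet -> R) :
  n_smooth n F -> n_smooth n (fun p => exp (F p)).
Proof.
intro hF.
assert (hd : forall p c, is_derive (fun s => exp (F (update p c s))) (p c)
                           (partial c F p * exp (F p))).
{ intros p c.
  apply (is_derive_comp exp (fun s => F (update p c s)) (p c) (exp (F p)) (partial c F p)).
  - rewrite update_same; apply is_derive_exp.
  - apply is_derive_partial, (n_smooth_regular _ _ p hF). }
assert (hr : forall p, continuous (fun p => exp (F p)) p /\
       forall c, ex_partial c (fun p => exp (F p)) p).
{ intro p; split; [|intro c; eexists; apply hd].
  apply (continuous_comp F exp); [apply (n_smooth_regular _ _ p hF)|].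
  apply (ex_derive_continuous exp); eexists; apply is_derive_exp. }
clear -hF hd hr; induction n as [|n IH]; [now split|].
split; [exact hr|intro c].
replace (partial c (fun p => exp (F p))) with (fun p => partial c F p * exp (F p)).
- apply n_smooth_mult; [apply hF|apply IH, n_smooth_pred, hF].
- apply functional_extensionality; intro p; symmetry; apply is_derive_unique, hd.
Qed.

Lemma continuous_coord (c : coord) (p : jet) : continuous (fun q : jet => q c) p.
Proof.
(* A ball in [coord -> R] bounds all coordinates at once, so the same radius serves. *)
apply filterlim_locally; intro eps; exists eps; intros q hq; apply hq.
Qed.

Lemma is_derive_update_coord (f f' : R -> R) (hf : forall t, is_derive f t (f' t)) (c d : coord)
  (p : jet) :
  is_derive (fun s => f (update p d s c)) (p d) (if coord_eq_dec d c then f' (p c) else 0).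
Proof.
unfold update; destruct (coord_eq_dec d c) as [->|]; [apply hf|apply @is_derive_const].
Qed.

(** Only the derivative in the direction [c] can be nonzero, and it is [f'] of the coordinate.
    Asking for [f'] one order lower lets this serve both antiderivatives and the induction for
    smooth functions of one variable. *)
Lemma n_smooth_of_coord (n : nat) (f f' : R -> R) (c : coord) :
  (forall t, is_derive f t (f' t)) ->
  match n with O => True | S m => n_smooth m (fun p => f' (p c)) end ->
  n_smooth n (fun p => f (p c)).
Proof.
intros hf h'.
assert (hr : forall p : jet, continuous (fun p : jet => f (p c)) p /\
       forall d, ex_partial d (fun p => f (p c)) p).
{ intro p; split.
  - apply (continuous_comp (fun q : jet => q c) f); [apply continuous_coord|].
    apply (ex_derive_continuous f); eexists; apply hf.
  - intro d; eexists; apply (is_derive_update_coord f f' hf). }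
destruct n as [|n]; [now split|].
split; [exact hr|intro d].
replace (partial d (fun p : jet => f (p c)))
  with (fun p : jet => if coord_eq_dec d c then f' (p c) else 0).
- destruct (coord_eq_dec d c); [exact h'|apply n_smooth_const].
- apply functional_extensionality; intro p; symmetry.
  apply is_derive_unique, (is_derive_update_coord f f' hf).
Qed.

Lemma n_smooth_antiderivative (n : nat) (f f' : R -> R) (c : coord) :
  (forall t, is_derive f t (f' t)) -> n_smooth n (fun p => f' (p c)) ->
  n_smooth n (fun p => f (p c)).
Proof.
intros hf h'; apply (n_smooth_of_coord n f f' c hf).
destruct n; [exact I|now apply n_smooth_pred].
Qed.

Lemma n_smooth_coord (n : nat) (c : coord) : n_smooth n (fun p => p c).
Proof.
apply (n_smooth_antiderivative n (fun s => s) (fun _ => 1)).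
- intro t; apply @is_derive_id.
- apply n_smooth_const.
Qed.

(** The blocks [h1] and [h2] are tried before the product rule, so that [exp (2 * H) * L] is kept
    whole. *)
Ltac n_smooth_poly h1 h2 :=
  repeat first [apply h1 | apply h2 | apply n_smooth_const | apply n_smooth_coord
               | apply n_smooth_plus | apply n_smooth_mult].

Lemma smooth_Derive (f : R -> R) : smooth f -> smooth (Derive f).
Proof.
(* [ex_derive_n] of order 0 is [True]; order [S n] for the derivative is order [S (S n)] for [f]. *)
intros h [|n] t; [exact I|].
apply (ex_derive_ext (Derive_n f (S n))).
- intro s; replace (S n) with (n + 1)%nat by lia; symmetry; apply (Derive_n_comp f n 1).
- apply (h (S (S n))).
Qed.

Lemma n_smooth_of_smooth (n : nat) (f : R -> R) (c : coord) :
  smooth f -> n_smooth n (fun p => f (p c)).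
Proof.
revert f; induction n as [|n IH]; intros f hf; apply (n_smooth_of_coord _ f (Derive f)); auto.
1,2: intro t; apply Derive_correct, (hf 1%nat).
apply IH, smooth_Derive, hf.
Qed.

(** ** Total derivatives of functions of finite order *)

Definition order_at_most (n : nat) (F : jet -> R) : Prop :=
  forall p q : jet, p ct = q ct -> p cx = q cx ->
    (forall i j : nat, (i + j <= n)%nat -> p (cu i j) = q (cu i j)) -> F p = F q.

(** Changing a coordinate of order above [n] leaves all those seen by [F] fixed, so the function
    being differentiated is constant. *)
Lemma partial_above_order (n : nat) (F : jet -> R) (i j : nat) (p : jet) :
  order_at_most n F -> (n < i + j)%nat -> partial (cu i j) F p = 0.
Proof.
intros hF hij; unfold partial.
rewrite (Derive_ext _ (fun _ => F p)); [apply Derive_const|].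
intro s; apply hF; unfold update; try reflexivity.
intros i' j' h; destruct (coord_eq_dec (cu i j) (cu i' j')) as [e|]; [|reflexivity].
injection e; lia.
Qed.

Lemma Series_eventually_zero (a : nat -> R) (n : nat) :
  (forall k, (n < k)%nat -> a k = 0) -> Series a = sum_f_R0 a n.
Proof.
intro h; apply is_series_unique, is_series_Reals; intros eps heps.
(* The partial sums no longer change after [n], so this rank works for every [eps]. *)
exists n; intros m hm.
replace (sum_f_R0 a m) with (sum_f_R0 a n); [now rewrite R_dist_eq|].
induction hm as [|m hm IH]; [reflexivity|].
simpl; rewrite <- IH, h; [ring|lia].
Qed.

Lemma sum_f_R0_zero (a : nat -> R) (n : nat) :
  (forall k, (k <= n)%nat -> a k = 0) -> sum_f_R0 a n = 0.
Proof.
induction n as [|n IH]; intro h; simpl; [apply h; lia|].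
rewrite IH, h; [ring|lia|intros; apply h; lia].
Qed.

(** For [i <= k] the coordinate [cu i (k - i)] has order exactly [k], so every group with [k > n]
    vanishes. *)
Lemma total_Dt_finite_order (n : nat) (F : jet -> R) (p : jet) :
  order_at_most n F ->
  total_Dt F p = partial ct F p +
    sum_f_R0 (fun k => sum_f_R0 (fun i =>
      p (cu (S i) (k - i)) * partial (cu i (k - i)) F p) k) n.
Proof.
intro hF; unfold total_Dt; f_equal; apply Series_eventually_zero; intros k hk.
apply sum_f_R0_zero; intros i hi.
rewrite (partial_above_order n); [ring|exact hF|lia].
Qed.

Lemma total_Dx_finite_order (n : nat) (F : jet -> R) (p : jet) :
  order_at_most n F ->
  total_Dx F p = partial cx F p +
    sum_f_R0 (fun k => sum_f_R0 (fun i =>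
      p (cu i (S (k - i))) * partial (cu i (k - i)) F p) k) n.
Proof.
intro hF; unfold total_Dx; f_equal; apply Series_eventually_zero; intros k hk.
apply sum_f_R0_zero; intros i hi.
rewrite (partial_above_order n); [ring|exact hF|lia].
Qed.

(** * Conservation laws and the given equation *)

Lemma conservation_law_of_characteristic_form (E Lam T X : jet -> R) :
  characteristic_form E Lam T X -> is_conservation_law E T X.
Proof.
intros (hT & hX & h); split; [exact hT|split; [exact hX|]].
intros D u hD [hu hE] t x hx.
rewrite <- (h D u hD hu t x hx), (hE t x hx); ring.
Qed.

(** [A = 0] removes one term and the other exponent is 1; [Rpower] to the exponent 1 returns its
    base when the base is positive. *)
Lemma general_equation_half (Q : R -> R) (p : jet) :
  0 < p (cu 0 0) -> general_equation (1 / 2) (fun _ => 0) Q p = equation Q p.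
Proof.
intro hp; unfold general_equation, equation.
replace (2 * (1 / 2)) with 1 by field.
rewrite (Rpower_1 _ hp); ring.
Qed.

Theorem mainTheorem5
  (Q H L : R -> R)
  (hQ : smooth Q)
  (hH : forall t : R, is_derive H t (Q t))
  (hL : forall t : R, is_derive L t (exp (- H t)))
  (c3 : R) :
  let Lam : jet -> R := fun p =>
    let t := p ct in let x := p cx in let u := p (cu 0 0) in
    c3 * (exp (H t) * x - exp (2 * H t) * L t * u) in
  let T : jet -> R := fun p =>
    let t := p ct in let x := p cx in let u := p (cu 0 0) in
    c3 / 2 * (2 * exp (H t) * x * u - exp (2 * H t) * L t * u ^ 2) in
  let X : jet -> R := fun p =>
    let t := p ct in let x := p cx in let u := p (cu 0 0) in
    let ux := p (cu 0 1) in let uxx := p (cu 0 2) in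
    c3 / 6 * (exp (H t) * x * (6 * uxx + 3 * u ^ 2)
              - exp (2 * H t) * L t * (2 * u ^ 3 - 3 * ux ^ 2 + 6 * u * uxx)
              - 6 * exp (H t) * ux) in
  (forall p : jet, 0 < p (cu 0 0) ->
     general_equation (1 / 2) (fun _ => 0) Q p = equation Q p) /\
  is_multiplier (equation Q) Lam /\
  characteristic_form (equation Q) Lam T X /\
  is_conservation_law (equation Q) T X.
Proof.
intros Lam T X.
assert (sH : forall n, n_smooth n (fun p => H (p ct))).
{ intro n; apply (n_smooth_antiderivative n H Q ct hH), n_smooth_of_smooth, hQ. }
assert (sL : forall n, n_smooth n (fun p => L (p ct))).
{ intro n; apply (n_smooth_antiderivative n L (fun t => exp (- H t)) ct hL).
  apply (n_smooth_exp n (fun p => - H (p ct))).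
  replace (fun p : jet => - H (p ct)) with (fun p : jet => -1 * H (p ct))
    by (apply functional_extensionality; intro; ring).
  apply n_smooth_mult; [apply n_smooth_const|apply sH]. }
assert (sE : forall n, n_smooth n (fun p => exp (H (p ct)))).
{ intro n; apply (n_smooth_exp n _ (sH n)). }
assert (sE2L : forall n, n_smooth n (fun p => exp (2 * H (p ct)) * L (p ct))).
{ intro n; apply n_smooth_mult; [|apply sL].
  apply (n_smooth_exp n (fun p => 2 * H (p ct))).
  apply n_smooth_mult; [apply n_smooth_const|apply sH]. }
assert (sLam : smooth_jet_fun Lam).
{ apply smooth_jet_fun_of_n_smooth; intro n.
  (* Differences and powers are rewritten as sums and products, the only operations [n_smooth_poly]
     treats. *)
  replace Lam with (fun p : jet => c3 * (exp (H (p ct)) * p cx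
    + -1 * (exp (2 * H (p ct)) * L (p ct) * p (cu 0 0))))
    by (apply functional_extensionality; intro p; unfold Lam; ring).
  n_smooth_poly sE sE2L. }
assert (sT : smooth_jet_fun T).
{ apply smooth_jet_fun_of_n_smooth; intro n.
  replace T with (fun p : jet => c3 / 2 * (2 * (exp (H (p ct)) * (p cx * p (cu 0 0)))
    + -1 * (exp (2 * H (p ct)) * L (p ct) * (p (cu 0 0) * p (cu 0 0)))))
    by (apply functional_extensionality; intro p; unfold T; ring).
  n_smooth_poly sE sE2L. }
assert (sX : smooth_jet_fun X).
{ apply smooth_jet_fun_of_n_smooth; intro n.
  replace X with (fun p : jet => c3 / 6 *
    (exp (H (p ct)) * (p cx * (6 * p (cu 0 2) + 3 * (p (cu 0 0) * p (cu 0 0))))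
     + (-1 * (exp (2 * H (p ct)) * L (p ct)
         * (2 * (p (cu 0 0) * (p (cu 0 0) * p (cu 0 0))) + (-3 * (p (cu 0 1) * p (cu 0 1))
            + 6 * (p (cu 0 0) * p (cu 0 2)))))
        + -6 * (exp (H (p ct)) * p (cu 0 1)))))
    by (apply functional_extensionality; intro p; unfold X; ring).
  n_smooth_poly sE sE2L. }
(* [T] involves only u, and [X] nothing beyond u_xx: one group of D_t T and three groups of D_x X
   survive. *)
assert (oT : order_at_most 0 T).
{ intros p q e1 e2 e3; unfold T; now rewrite e1, e2, !e3 by lia. }
assert (oX : order_at_most 2 X).
{ intros p q e1 e2 e3; unfold X; now rewrite e1, e2, !e3 by lia. }
assert (key : forall p, equation Q p * Lam p = total_Dt T p + total_Dx X p).
{ intro p.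
  rewrite (total_Dt_finite_order 0 T p oT), (total_Dx_finite_order 2 X p oX); simpl.
  assert (hexp : exp (2 * H (p ct)) = exp (H (p ct)) * exp (H (p ct)))
    by (rewrite <- exp_plus; f_equal; ring).
  assert (hTt : partial ct T p = c3 / 2 * (2 * Q (p ct) * exp (H (p ct)) * p cx * p (cu 0 0)
    - (2 * Q (p ct) * exp (2 * H (p ct)) * L (p ct) + exp (H (p ct))) * p (cu 0 0) ^ 2)).
  { apply is_derive_unique; unfold T, update; simpl.
    auto_derive.
    - assert (eH : ex_derive H (p ct)) by (eexists; apply hH).
      assert (eL : ex_derive L (p ct)) by (eexists; apply hL).
      repeat split; assumption.
    - assert (dH : Derive (fun s : R => H s) (p ct) = Q (p ct))
        by apply is_derive_unique, hH.
      assert (dL : Derive (fun s : R => L s) (p ct) = exp (- H (p ct)))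
        by apply is_derive_unique, hL.
      rewrite dH, dL.
      (* Everything is expressed through [exp (H (p ct))], whose inverse comes from [L']; hence the
         condition that it is nonzero. *)
      rewrite hexp, exp_Ropp; field; apply exp_neq_0. }
  (* This value is [Lam p]: it multiplies u_t in D_t T, giving the u_t part of [E * Lam]. *)
  assert (hTu : partial (cu 0 0) T p
    = c3 * (exp (H (p ct)) * p cx - exp (2 * H (p ct)) * L (p ct) * p (cu 0 0))).
  { apply is_derive_unique; unfold T, update; simpl; auto_derive; [exact I|field]. }
  assert (hXx : partial cx X p
    = c3 / 6 * exp (H (p ct)) * (6 * p (cu 0 2) + 3 * p (cu 0 0) ^ 2)).
  { apply is_derive_unique; unfold X, update; simpl; auto_derive; [exact I|field]. }
  assert (hXu : partial (cu 0 0) X p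
    = c3 * (exp (H (p ct)) * p cx * p (cu 0 0)
            - exp (2 * H (p ct)) * L (p ct) * (p (cu 0 0) ^ 2 + p (cu 0 2)))).
  { apply is_derive_unique; unfold X, update; simpl; auto_derive; [exact I|field]. }
  assert (hXux : partial (cu 0 1) X p
    = c3 * (exp (2 * H (p ct)) * L (p ct) * p (cu 0 1) - exp (H (p ct)))).
  { apply is_derive_unique; unfold X, update; simpl; auto_derive; [exact I|field]. }
  (* Again [Lam p], now as the factor of u_xxx in D_x X. *)
  assert (hXuxx : partial (cu 0 2) X p
    = c3 * (exp (H (p ct)) * p cx - exp (2 * H (p ct)) * L (p ct) * p (cu 0 0))).
  { apply is_derive_unique; unfold X, update; simpl; auto_derive; [exact I|field]. }
  (* The groups of D_x X up to order 2 also run over u_t, u_tt and u_tx, on which [X] does not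
     depend. *)
  assert (hX0 : forall i j, partial (cu (S i) j) X p = 0).
  { intros i j; apply is_derive_unique; unfold X, update; simpl; apply @is_derive_const. }
  rewrite hTt, hTu, hXx, hXu, hXux, hXuxx, !hX0.
  (* Up to the factor [c3], the explicit x-derivative of [X] supplies [exp H] times u_xx + u^2/2:
     the u^2 part cancels against the [L'] term of D_t T, the u_xx part against the term of [X]
     linear in u_x. *)
  unfold equation, Lam; field. }
assert (char : characteristic_form (equation Q) Lam T X).
{ split; [split; [now exists 0%nat|exact sT]|].
  split; [split; [now exists 2%nat|exact sX]|intros; apply key]. }
split; [apply general_equation_half|split; [|split]].
- split; [|split; [exact sLam|now exists T, X]].
  exists 0%nat; intros p q e1 e2 e3; unfold Lam; now rewrite e1, e2, e3 by lia.
- exact char.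
- exact (conservation_law_of_characteristic_form _ _ _ _ char).
Qed.
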